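(* There exist absolute constants $c_*>0$ and $K>0$ such that for every integer $d\geqslant 1$, $$\bigl| i(H^{mod}_d) - 3\cdot 4^d - d\cdot 3^{d+1}\bigr| \leqslant K(3-c_* )^d .$$ In particular, $i(H^{mod}_d) = 3\cdot 4^d + O((4-c_* )^d)$.
   Context: For a hypergraph $H=(V,E)$, a set $W\subseteq V$ is independent if no edge $e\in E$ satisfies $e\subseteq W$; $i(H)$ denotes the number of independent sets of $H$ (the empty set included). The hypergraph $H^{mod}_d=(V,E)$ has vertex set $V=V_1\sqcup V_2\sqcup V_3$, where each $V_i$ is a disjoint copy of the cyclic group $\mathbb{Z}/d\mathbb{Z}$, and edge set $E=\{\{x,y,z\}: x\in V_1,\ y\in V_2,\ z\in V_3,\ x+y\equiv z \pmod d\}$. It is $3$-uniform, $d$-regular and linear. *)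

(* Defs.v *)
From HB Require Import structures.
From mathcomp Require Import all_boot all_order all_algebra.
From mathcomp Require Import reals.
Set Implicit Arguments. Unset Strict Implicit. Unset Printing Implicit Defensive.

(* A hypergraph on a finite vertex type V is given by its edge set E. *)
Definition independent (V : finType) (E : {set {set V}}) (W : {set V}) : bool :=
  [forall e in E, ~~ (e \subset W)].

Definition num_indep (V : finType) (E : {set {set V}}) : nat :=
  #|[set W : {set V} | independent E W]|.

(* Vertex set V_1 ⊔ V_2 ⊔ V_3, each a copy of Z/dZ represented by 'I_d:
   V_1 = inl (inl _), V_2 = inl (inr _), V_3 = inr _. *)
Definition Vmod (d : nat) : finType := ('I_d + 'I_d + 'I_d)%type.

Definition Emod (d : nat) : {set {set Vmod d}} :=
  [set e : {set Vmod d} | [exists x : 'I_d, exists y : 'I_d, exists z : 'I_d,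
     ((x + y) %% d == z %% d)
     && (e == [set (inl (inl x) : Vmod d); inl (inr y); inr z])]].

Definition i_Hmod (d : nat) : nat := num_indep (Emod d).

(* Main.v *)
(* An independent set is a triple (A, B, C) with no solution of a + b = c.
   Triples with |A| <= 1 number exactly 4^d + d 3^d, likewise for B and C, and
   the overlaps are of order d^2 2^d; it remains to bound triples in which all
   three sets have at least two elements.
   If some set, say A, has between 2 and k elements, two of its elements confine
   (B, C) to an independent set of a union of two disjoint perfect matchings;
   covering this 2-regular graph by paths on 4 vertices (8 independent sets) and
   edges (3) gives at most 24^(d/3) pairs.
   If all three sets have at least k elements, choose k-subsets F, G, H of A, B,
   C. Then (A, B, C) is an independent set of the 2k-regular graph on 3d vertices
   that joins two vertices when some element of F, G or H completes them to a
   hyperedge, and for large k a regular graph on n vertices has about 2^(n/2)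
   independent sets, here 2^(3d/2) < 3^d. The d^(3k) choices of F, G, H are
   absorbed since k is a constant.
   Only the Latin square property of a + b = c is used, which makes the three
   parts interchangeable. *)
Require Import Defs.
From HB Require Import structures.
From mathcomp Require Import all_boot all_order all_algebra.
From mathcomp Require Import reals.
From mathcomp Require Import zify ring lra.
Import Order.TTheory GRing.Theory Num.Theory.

Set Implicit Arguments. Unset Strict Implicit. Unset Printing Implicit Defensive.

(** * Counting independent sets of a graph *)

Section IndependentSets.
Variables (V : finType) (g : rel V).
Implicit Types (S W X : {set V}) (v : V).

Definition stable W := [forall x in W, forall y in W, ~~ g x y].
Definition stables S := [set W : {set V} | (W \subset S) && stable W].

Lemma stableP W : reflect (forall x y, x \in W -> y \in W -> ~~ g x y) (stable W).
Proof.
apply: (iffP forall_inP) => [h x y xW yW|h x xW].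
  by move/forall_inP: (h x xW); apply.
by apply/forall_inP => y; apply: h.
Qed.

Lemma stableS X W : X \subset W -> stable W -> stable X.
Proof.
move=> /subsetP sXW /stableP h; apply/stableP => x y xX yX.
by apply: h; apply: sXW.
Qed.

Lemma card_stables_exp S : #|stables S| <= 2 ^ #|S|.
Proof.
rewrite -card_powerset; apply/subset_leq_card/subsetP => W.
by rewrite !inE => /andP[].
Qed.

Lemma card_stablesS S X : S \subset X -> #|stables S| <= #|stables X|.
Proof.
move=> sSX; apply/subset_leq_card/subsetP => W; rewrite !inE => /andP[sWS ->].
by rewrite (subset_trans sWS).
Qed.

(** Split by membership of [v]: a stable set containing [v] has no neighbour of [v], and removing
    [v] is injective on such sets. *)
Lemma card_stablesD1 v S :
  #|stables S| <= #|stables (S :\ v)| + #|stables (S :\ v :\: [set u | g v u])|.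
Proof.
rewrite -(cardsID [set W : {set V} | v \in W] (stables S)) addnC; apply: leq_add.
  apply/subset_leq_card/subsetP => W; rewrite !inE => /andP[vW /andP[sWS ->]].
  by rewrite andbT subsetD1 sWS.
set Y := _ :&: _.
have injY : {in Y &, injective (fun W : {set V} => W :\ v)}.
  move=> W W'; rewrite !inE => /andP[_ vW] /andP[_ vW'] e.
  by rewrite -(setD1K vW) e setD1K.
rewrite -(card_in_imset injY); apply/subset_leq_card/subsetP => Z /imsetP[W + ->].
rewrite !inE => /andP[/andP[/subsetP sWS stW] vW].
rewrite (stableS _ stW) ?subD1set // andbT.
apply/subsetP => u; rewrite !inE => /andP[uv uW].
by rewrite uv sWS // andbT /= (stableP _ stW).
Qed.

Lemma card_stablesU S X : #|stables (S :|: X)| <= #|stables S| * #|stables X|.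
Proof.
rewrite -cardsX.
have inj : {in stables (S :|: X) &, injective (fun W : {set V} => (W :&: S, W :&: X))}.
  move=> W W'; rewrite !inE => /andP[sW _] /andP[sW' _] [e1 e2].
  by rewrite -(setIidPl sW) -(setIidPl sW') !setIUr e1 e2.
rewrite -(card_in_imset inj); apply/subset_leq_card/subsetP => Z /imsetP[W + ->].
rewrite !inE => /andP[_ stW] /=.
by rewrite !subsetIr !(stableS _ stW) ?subsetIl.
Qed.

Lemma card_stables_bigcup (J : finType) (P : pred J) (F : J -> {set V}) (b : nat) :
  (forall j, P j -> #|stables (F j)| <= b) ->
  #|stables (\bigcup_(j | P j) F j)| <= b ^ #|P|.
Proof.
move=> h; rewrite -prod_nat_const.
apply: (big_ind2 (fun S n => #|stables S| <= n)) => //.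
- by rewrite (leq_trans (card_stables_exp _)) // cards0.
- by move=> S m X n hS hX; rewrite (leq_trans (card_stablesU _ _)) // leq_mul.
Qed.

Lemma card_stables_edge x y : g x y -> #|stables [set x; y]| <= 3.
Proof.
move=> gxy; apply: (leq_trans (card_stablesD1 x _)).
have h1 : #|[set x; y] :\ x| <= 1.
  rewrite -(cards1 y); apply/subset_leq_card/subsetP => u.
  by rewrite !inE => /andP[/negPf ->].
have h2 : #|[set x; y] :\ x :\: [set u | g x u]| <= 0.
  rewrite leqn0 cards_eq0 -subset0; apply/subsetP => u; rewrite !inE.
  by case/and3P=> /negP gu /negPf -> /eqP e; rewrite e gxy in gu.
rewrite (@leq_add _ _ 2 1) //; apply: leq_trans (card_stables_exp _) _.
  by rewrite (@leq_exp2l 2 _ 1).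
by rewrite (@leq_exp2l 2 _ 0).
Qed.

(** Branch on [y], then on [z]: with [y] only [t] stays free (2 sets); without [y], there are at
    most 2 sets with [z] and 4 without. *)
Lemma card_stables_path x y z t :
  g y x -> g y z -> g z t -> #|stables [set x; y; z; t]| <= 8.
Proof.
move=> gyx gyz gzt.
have h1 : #|stables ([set x; y; z; t] :\ y :\: [set u | g y u])| <= 2.
  rewrite (leq_trans (card_stables_exp _)) // (@leq_exp2l 2 _ 1) // -(cards1 t).
  apply/subset_leq_card/subsetP => u; rewrite !inE => /and3P[gu /negPf ->].
  by case/orP=> // /orP[]; rewrite ?orbF => /eqP e; rewrite e ?gyx ?gyz in gu.
have h2 : #|stables ([set x; y; z; t] :\ y)| <= 4 + 2.
  apply: (leq_trans (card_stablesD1 z _)); apply: leq_add.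
    rewrite (leq_trans (card_stables_exp _)) // (@leq_exp2l 2 _ 2) //.
    apply: (@leq_trans #|[set x; t]|); last by rewrite cards2; case: eqP.
    apply/subset_leq_card/subsetP => u; rewrite !inE.
    by case/and3P=> /negPf -> /negPf ->; rewrite !orbF.
  rewrite (leq_trans (card_stables_exp _)) // (@leq_exp2l 2 _ 1) // -(cards1 x).
  apply/subset_leq_card/subsetP => u; rewrite !inE => /and4P[gu /negPf -> /negPf ->].
  by rewrite !orbF => /orP[] // /eqP e; rewrite e gzt in gu.
by apply: (leq_trans (card_stablesD1 y _)); rewrite (@leq_add _ _ 6 2).
Qed.

(** Double count the edges leaving [S]: each vertex of [S] sends out at least [D - psi] of them, and
    each outside vertex receives at most [D]. *)
Lemma regular_sparse_card (D psi : nat) S :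
    symmetric g -> (forall v, #|[set u | g v u]| = D) ->
    (forall v, v \in S -> #|[set u in S | g v u]| <= psi) ->
  #|S| * D.*2 <= #|S| * psi + D * #|V|.
Proof.
move=> gC gD hS.
have e1 : #|S| * D <= #|S| * psi + \sum_(v in S) \sum_(u in ~: S) g v u.
  rewrite -!sum_nat_const -big_split /=; apply: leq_sum => v vS.
  rewrite -(gD v) -(cardsID S) leq_add //.
    by apply: leq_trans (hS v vS); apply/subset_leq_card/subsetP => u; rewrite !inE andbC.
  rewrite -big_mkcondr sum1dep_card; apply/subset_leq_card/subsetP => u.
  by rewrite !inE.
have e2 : \sum_(v in S) \sum_(u in ~: S) g v u <= #|~: S| * D.
  rewrite exchange_big /= -sum_nat_const; apply: leq_sum => u _.
  rewrite -(gD u) -big_mkcondr sum1dep_card; apply/subset_leq_card/subsetP => v.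
  by rewrite !inE gC => /andP[].
have := cardsC S; nia.
Qed.

Local Open Scope ring_scope.

(* Deleting or selecting a vertex of degree at least [psi] loses at most a
   factor [lam]; once no such vertex is left, regularity makes [S] small. *)
Lemma card_stables_regular (R : realFieldType) (D psi : nat) (M lam : R) S :
    symmetric g -> irreflexive g -> (forall v, #|[set u | g v u]| = D) ->
    1 <= lam -> 1 <= (lam - 1) * lam ^+ psi ->
    (forall X : {set V}, (#|X| * D.*2 <= #|X| * psi + D * #|V|)%N ->
       2 ^+ #|X| <= M) ->
  #|stables S|%:R <= M * lam ^+ #|S|.
Proof.
move=> gC gI gD lam1 lampsi hM.
have lam0 : 0 <= lam by apply: le_trans lam1.
have M0 : 0 <= M.
  by apply: le_trans (hM set0 _); rewrite ?cards0 ?expr0 ?ler01 // mul0n.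
have [n le_Sn] := ubnP #|S|; elim: n S le_Sn => // n IHn S le_Sn.
have [/exists_inP[v vS hv]|/exists_inPn hS] :=
    boolP [exists v in S, (psi < #|[set u in S | g v u]|)%N].
  have sv : #|S| = #|S :\ v|.+1 by rewrite (cardsD1 v) vS.
  set X := S :\ v :\: [set u | g v u].
  have sX : (#|X| + psi <= #|S :\ v|)%N.
    rewrite -(cardsID [set u | g v u] (S :\ v)) addnC leq_add2r.
    apply: leq_trans (ltnW hv) _; apply/subset_leq_card/subsetP => u.
    rewrite !inE => /andP[-> guv]; rewrite guv !andbT.
    by apply: contraTneq guv => ->; rewrite gI.
  apply: le_trans (_ : (#|stables (S :\ v)| + #|stables X|)%:R <= _).
    by rewrite ler_nat card_stablesD1.
  rewrite natrD.
  apply: le_trans (lerD (IHn (S :\ v) _) (IHn X _)) _; first by lia.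
    by lia.
  rewrite sv exprS -mulrDr ler_wpM2l //.
  (* The branch without [v] already uses [lam ^+ #|S :\ v|]; the other must fit in the remaining
     factor [lam - 1], which works since [X] has at least [psi] fewer elements than [S :\ v]. *)
  suff : lam ^+ #|X| <= (lam - 1) * lam ^+ #|S :\ v| by lra.
  apply: le_trans (_ : (lam - 1) * lam ^+ (#|X| + psi) <= _).
    rewrite exprD mulrCA -[leLHS]mulr1 ler_wpM2l ?exprn_ge0 //.
  by rewrite ler_wpM2l ?subr_ge0 // ler_weXn2l.
apply: le_trans (_ : (2 ^ #|S|)%:R <= _).
  by rewrite ler_nat card_stables_exp.
rewrite natrX; apply: le_trans (hM S _) _.
  apply: regular_sparse_card => // v vS; rewrite leqNgt; exact: hS.
by rewrite -[leLHS]mulr1 ler_wpM2l // exprn_ege1.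
Qed.

End IndependentSets.

(** A path accounts for two elements and an edge for one. Pairing each edge with a path gives
    exactly [8 * 3 = 24] per three elements; for the surplus paths,
    [8 ^ 3 = 512 <= 576 = 24 ^ 2]. *)
Lemma path_edge_bound p l : l <= p -> (8 ^ p * 3 ^ l) ^ 3 <= 24 ^ (p + p + l).
Proof.
move=> lp; rewrite -(subnK lp); move: (p - l) => q.
have cube a n : (a ^ n) ^ 3 = (a ^ 3) ^ n by rewrite -!expnM mulnC.
have -> : (8 ^ (q + l) * 3 ^ l) ^ 3 = (8 ^ 3 * 3 ^ 3) ^ l * (8 ^ 3) ^ q.
  by rewrite expnMn !cube (expnMn _ _ l) (expnD _ q) -mulnA mulnC.
have -> : 24 ^ (q + l + (q + l) + l) = (8 ^ 3 * 3 ^ 3) ^ l * (24 ^ 2) ^ q.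
  rewrite (_ : 8 ^ 3 * 3 ^ 3 = 24 ^ 3) //.
  by rewrite -(expnM _ 3) -(expnM _ 2) -expnD; congr (_ ^ _); lia.
rewrite leq_mul2l; apply/orP; right.
by elim: q => // q IHq; rewrite !(expnS _ q) leq_mul.
Qed.

(** * Triples of sets avoiding a Latin square *)

Section Latin.
Variable I : finType.
Implicit Types (T : I -> I -> I -> bool) (A B C : {set I}).

Let triple : finType := ({set I} * {set I} * {set I})%type.

Definition latin T :=
  [/\ forall x y, #|[set z | T x y z]| = 1,
      forall x z, #|[set y | T x y z]| = 1 &
      forall y z, #|[set x | T x y z]| = 1].

Definition avoid T A B C :=
  [forall x in A, forall y in B, forall z in C, ~~ T x y z].

Definition rot T y z x := T x y z.

Definition count_avoid T (P : {set I} -> {set I} -> {set I} -> bool) :=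
  #|[set t : triple | avoid T t.1.1 t.1.2 t.2 && P t.1.1 t.1.2 t.2]|.

Lemma avoidP T A B C :
  reflect (forall x y z, x \in A -> y \in B -> z \in C -> ~~ T x y z)
          (avoid T A B C).
Proof.
apply: (iffP forall_inP) => [h x y z xA yB zC|h x xA].
  by move/forall_inP: (h x xA) => /(_ y yB) /forall_inP; apply.
by apply/forall_inP => y yB; apply/forall_inP => z; apply: h.
Qed.

Lemma latin_rot T : latin T -> latin (rot T).
Proof. by case=> h1 h2 h3; split=> [y z|y x|z x]; rewrite /rot; auto. Qed.

Lemma avoid_rot T A B C : avoid (rot T) B C A = avoid T A B C.
Proof. by apply/avoidP/avoidP => h x y z xA yB zC; apply: h. Qed.

(** Lets every estimate be proved for the first set only: the others follow by applying it to
    [rot T] and [rot (rot T)]. *)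
Lemma count_avoid_rot T P :
  count_avoid (rot T) (fun B C A => P A B C) = count_avoid T P.
Proof.
pose r (t : triple) : triple := (t.1.2, t.2, t.1.1).
pose r' (t : triple) : triple := (t.2, t.1.1, t.1.2).
have rK : cancel r r' by case=> [[A B] C].
rewrite /count_avoid -(card_preimset _ (can_inj rK)); apply: eq_card => t.
by rewrite !inE /= avoid_rot.
Qed.

Lemma count_avoid_sum T P :
  count_avoid T P = \sum_A \sum_B #|[set C | avoid T A B C && P A B C]|.
Proof.
rewrite pair_bigA /= /count_avoid -sum1dep_card.
under [RHS]eq_bigr do rewrite -sum1dep_card.
by rewrite pair_big_dep.
Qed.

(** Fixing one coordinate leaves a perfect matching between the other two parts. *)
Lemma latin_fun T x : latin T ->
  exists2 m : I -> I, injective m & forall y z, T x y z = (m y == z).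
Proof.
case=> h1 h2 _.
have /fin_all_exists[m hm] y : exists z, [set z | T x y z] = [set z].
  by apply/cards1P; rewrite h1.
have Tm y z : T x y z = (m y == z).
  by have /setP/(_ z) := hm y; rewrite !inE eq_sym.
exists m => // y y' e; have /eqP/cards1P[w hw] := h2 x (m y).
have /setP/(_ y) := hw; have /setP/(_ y') := hw.
by rewrite !inE !Tm e eqxx => /esym/eqP-> /esym/eqP.
Qed.

Lemma latin_neq T x x' y z : latin T -> x != x' -> T x y z -> ~~ T x' y z.
Proof.
case=> _ _ h3 xx' Txyz; apply: contraNN xx' => Tx'yz.
have /eqP/cards1P[w /setP hw] := h3 y z.
have := hw x; have := hw x'.
by rewrite !inE Txyz Tx'yz => /esym/eqP-> /esym/eqP->.
Qed.

Lemma card_sets : #|{: {set I}}| = 2 ^ #|I|.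
Proof. by rewrite -[LHS]cardsT -powersetT card_powerset cardsT. Qed.

(** Expand the product of [1 + 2] over [I], taking the term 1 on [B] and the term 2 off it. *)
Lemma sum_exp2_card_setC : \sum_(B : {set I}) 2 ^ #|~: B| = 3 ^ #|I|.
Proof.
transitivity (\prod_(i : I) (1 + 2)); last by rewrite prod_nat_const.
have /= -> := @bigA_distr _ 0 1 muln addn I (fun=> 1) (fun=> 2).
apply: eq_big => [B|B _]; first by rewrite inE.
rewrite -prod_nat_const [RHS](bigID (mem B)) /= [X in _ = X * _]big1 => [|i ->//].
rewrite mul1n; apply: eq_big => i; first by rewrite in_setC.
by rewrite in_setC => /negPf->.
Qed.

(** For empty [A], both [B] and [C] are free. For [A = [set a]], [C] ranges over the subsets of the
    complement of [m @: B], and summing over [B] gives [3 ^ #|I|]. *)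
Lemma count_avoid_le1 T : latin T ->
  count_avoid T (fun A _ _ => #|A| <= 1) = 4 ^ #|I| + #|I| * 3 ^ #|I|.
Proof.
move=> lT; rewrite count_avoid_sum (bigD1 set0) //=; congr (_ + _).
  transitivity (\sum_(B : {set I}) 2 ^ #|I|).
    apply: eq_bigr => B _; rewrite -card_sets.
    apply: eq_card => C; rewrite !inE cards0 andbT; apply/avoidP => x y z.
    by rewrite inE.
  by rewrite sum_nat_const card_sets -expnMn.
pose f A := \sum_B #|[set C | avoid T A B C && (#|A| <= 1)]|.
rewrite -/(f _) (bigID (fun A => #|A| <= 1)) /= [X in _ + X]big1 => [|A]; last first.
  case/andP=> _ /negPf h; rewrite /f big1 // => B _; apply: eq_card0 => C.
  by rewrite inE h andbF.
rewrite addn0 (eq_bigl (fun A => A \in [set [set a] | a in I])) => [|A]; last first.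
  apply/andP/imsetP => [[A0 A1]|[a _ ->]].
    have /cards1P[a ->] : #|A| == 1 by rewrite eqn_leq A1 card_gt0.
    by exists a.
  by rewrite cards1 -card_gt0 cards1.
rewrite big_imset /=; last by move=> a b _ _; apply: set1_inj.
rewrite -sum_nat_const; apply: eq_bigr => a _; rewrite /f cards1.
rewrite -sum_exp2_card_setC; apply: eq_bigr => B _.
have [m m_inj Tm] := latin_fun a lT.
transitivity #|powerset (~: (m @: B))|; last first.
  rewrite card_powerset; congr (2 ^ _); apply/eqP.
  by rewrite -(eqn_add2l #|B|) cardsC -(card_imset _ m_inj) cardsC.
apply: eq_card => C; rewrite !inE andbT.
apply/avoidP/subsetP => [h z zC|h x y z /set1P-> yB zC].
  rewrite inE; apply/imsetP => -[y yB e].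
  by have := h a y z (set11 _) yB zC; rewrite Tm e eqxx.
have := h z zC; rewrite inE Tm; apply: contraNN => /eqP<-.
exact: imset_f.
Qed.

(** A set with at most [k] elements is listed by [k] entries of [option I], padded with [None]. *)
Lemma card_sets_le k : #|[set A : {set I} | #|A| <= k]| <= #|I|.+1 ^ k.
Proof.
pose F (f : {ffun 'I_k -> option I}) := [set x | Some x \in codom f].
apply: (@leq_trans #|F @: setT|); last first.
  by rewrite (leq_trans (leq_imset_card _ _)) // cardsT card_ffun card_option card_ord.
apply/subset_leq_card/subsetP => A; rewrite inE => Ak.
apply/imsetP; exists [ffun i : 'I_k => nth None (map Some (enum A)) i] => //.
apply/setP => x; rewrite !inE; apply/idP/codomP => [xA|[i]].
  have lt_i : index x (enum A) < k.
    by rewrite (leq_trans _ Ak) // cardE index_mem mem_enum.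
  exists (Ordinal lt_i); rewrite ffunE /= (nth_map x) ?nth_index ?mem_enum //.
  by rewrite index_mem mem_enum.
rewrite ffunE; have [lt_i|ge_i] := ltnP i (size (enum A)).
  by rewrite (nth_map x) // => -[->]; rewrite -mem_enum mem_nth.
by rewrite nth_default // size_map.
Qed.

Lemma count_avoid_le1_le1 T :
  count_avoid T (fun A B _ => (#|A| <= 1) && (#|B| <= 1))
    <= #|I|.+1 ^ 2 * 2 ^ #|I|.
Proof.
pose X := [set A : {set I} | #|A| <= 1].
apply: (@leq_trans #|setX (setX X X) [set: {set I}]|).
  apply/subset_leq_card/subsetP => t; rewrite !inE => /andP[_ ->] //.
rewrite !cardsX cardsT card_sets leq_mul2r; apply/orP; right.
by rewrite (@leq_mul _ _ (#|I|.+1 ^ 1) (#|I|.+1 ^ 1)) // card_sets_le.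
Qed.

(** * Two disjoint perfect matchings, and triples with a small set *)

Section TwoMatchings.
Variables m m' : I -> I.
Hypotheses (m_inj : injective m) (m'_inj : injective m').
Hypothesis mm' : forall y, m y != m' y.

Definition two_matchings (u v : I + I) :=
  match u, v with
  | inl y, inr z | inr z, inl y => (m y == z) || (m' y == z)
  | _, _ => false
  end.

(** Cubing keeps the bound [24 ^ (#|I| / 3)] within the integers. *)
Lemma card_stables_two_matchings :
  #|stables two_matchings setT| ^ 3 <= 24 ^ #|I|.
Proof.
(* [s] goes along [m'] and back along [m]; it has no fixed point because the matchings are
   disjoint. *)
pose s y := invF m_inj (m' y).
have ms y : m (s y) = m' y by rewrite /s f_invF.
have s_inj : injective s by move=> y y' /(can_inj (f_invF m_inj)) /m'_inj.
have s_neq y : s y != y by apply: contraNneq (mm' y) => e; rewrite -{1}e ms.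
(* A maximal P disjoint from s @: P has at least |I| / 3 elements. *)
pose good (P : {set I}) := [disjoint P & s @: P].
have [|P gP maxP] := @arg_maxnP _ set0 good (fun P => #|P|).
  by rewrite /good -setI_eq0 set0I.
(* Otherwise [x] could be added to [P], against maximality. *)
have cov x : [|| x \in P, x \in s @: P | s x \in P].
  apply/negPn; apply/negP; rewrite !negb_or => /and3P[xP xsP sxP].
  suff /maxP : good (x |: P) by rewrite cardsU1 xP /= ltnn.
  rewrite /good imsetU1 -setI_eq0; apply/eqP/setP => y; rewrite !inE.
  apply/negP => /andP[/orP[/eqP->|yP] /orP[/eqP e|ysP]].
  - by have := s_neq x; rewrite -e eqxx.
  - by rewrite ysP in xsP.
  - by rewrite -e yP in sxP.
  - by have := disjointFr gP yP; rewrite ysP.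
set p := #|P|.
have cardsP : #|s @: P| = p by rewrite card_imset.
pose L := ~: (P :|: s @: P).
have dp : p + p + #|L| = #|I|.
  rewrite -(cardsC (P :|: s @: P)); congr (_ + _).
  by rewrite cardsU (disjoint_setI0 gP) cards0 subn0 cardsP.
(* By [cov], the injection [s] maps [L] into [P]. *)
have Lp : #|L| <= p.
  rewrite -(card_imset _ s_inj); apply/subset_leq_card/subsetP => z.
  case/imsetP=> x; rewrite !inE => xL ->; have := cov x.
  by move: xL; do 2![case: (_ \in _)] => //=.
have le_cov : #|stables two_matchings setT| <= 8 ^ p * 3 ^ #|L|.
  (* The path [F x] contains the matching edges [G x] and [G (s x)], as [m (s x) = m' x]. So paths
     over [P] and edges over [L] cover every vertex. *)
  pose F x := [set inr (m x); inl x; inr (m' x); inl (s x)] : {set I + I}.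
  pose G x := [set inl x; inr (m x)] : {set I + I}.
  apply: (@leq_trans #|stables two_matchings
      (\bigcup_(x in P) F x :|: \bigcup_(x in L) G x)|).
    apply: card_stablesS; apply/subsetP => u _.
    have [x ux] : exists x, u \in G x.
      case: u => [x|z]; first by exists x; rewrite !inE eqxx.
      by exists (invF m_inj z); rewrite !inE f_invF eqxx orbT.
    rewrite inE; have [xP|xP] := boolP (x \in P).
      apply/orP; left; apply/bigcupP; exists x => //.
      by move: ux; rewrite !inE => /orP[]->; rewrite ?orbT.
    have [/imsetP[y yP e]|xsP] := boolP (x \in s @: P).
      apply/orP; left; apply/bigcupP; exists y => //.
      by move: ux; rewrite e !inE ms => /orP[]->; rewrite ?orbT.
    by apply/orP; right; apply/bigcupP; exists x; rewrite // !inE negb_or xP.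
  apply: leq_trans (card_stablesU _ _ _) _.
  apply: leq_mul; apply: card_stables_bigcup => x _.
    by apply: card_stables_path; rewrite /= ?ms ?eqxx ?orbT.
  by apply: card_stables_edge; rewrite /= eqxx.
apply: (@leq_trans ((8 ^ p * 3 ^ #|L|) ^ 3)); first by rewrite leq_exp2r.
by rewrite -dp; apply: path_edge_bound.
Qed.

End TwoMatchings.

Lemma card_avoid_two T A : latin T -> 1 < #|A| ->
  #|[set q : {set I} * {set I} | avoid T A q.1 q.2]| ^ 3 <= 24 ^ #|I|.
Proof.
move=> lT /card_gt1P[a [a' [aA a'A aa']]].
have [m m_inj Tm] := latin_fun a lT; have [m' m'_inj Tm'] := latin_fun a' lT.
have mm' y : m y != m' y.
  by rewrite eq_sym -Tm'; apply: latin_neq lT aa' _; rewrite Tm.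
apply: leq_trans (card_stables_two_matchings m_inj m'_inj mm').
rewrite leq_exp2r //.
pose w (q : {set I} * {set I}) : {set I + I} :=
  [set u | match u with inl y => y \in q.1 | inr z => z \in q.2 end].
have w_inj : injective w.
  move=> [B C] [B' C'] /setP e; congr (_, _); apply/setP => x.
    by have := e (inl x); rewrite !inE.
  by have := e (inr x); rewrite !inE.
rewrite -(card_imset _ w_inj); apply/subset_leq_card/subsetP => W /imsetP[[B C]].
rewrite !inE /= => /avoidP h ->; rewrite subsetT; apply/stableP => u v.
have ok y z : y \in B -> z \in C -> ~~ ((m y == z) || (m' y == z)).
  by move=> yB zC; rewrite -Tm -Tm' negb_or !h.
by case: u v => [y|z] [y'|z'] //=; rewrite !inE /= => *; apply: ok.
Qed.

Lemma count_avoid_small T k : latin T ->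
  exists2 x, x ^ 3 <= 24 ^ #|I| &
    count_avoid T (fun A _ _ => 1 < #|A| <= k) <= #|I|.+1 ^ k * x.
Proof.
move=> lT; pose f A := #|[set q : {set I} * {set I} | avoid T A q.1 q.2]|.
(* The worst number of pairs [(B, C)] over all [A] with at least two elements. *)
exists (\max_(A : {set I} | 1 < #|A|) f A).
  apply: (big_ind (fun x => x ^ 3 <= 24 ^ #|I|)) => //.
    by move=> x y hx hy; rewrite /maxn; case: ifP.
  by move=> A; apply: card_avoid_two.
apply: (@leq_trans (\sum_(A : {set I} | 1 < #|A| <= k) f A)).
  rewrite count_avoid_sum [X in _ <= X]big_mkcond; apply: leq_sum => A _.
  case: ifP => _; last first.
    by rewrite big1 // => B _; apply: eq_card0 => C; rewrite inE andbF.
  rewrite /f -sum1dep_card.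
  rewrite -(pair_big_dep xpredT (fun B C => avoid T A B C) (fun _ _ => 1)) /=.
  apply: leq_sum => B _; rewrite sum1dep_card; apply/subset_leq_card/subsetP => C.
  by rewrite !inE => /andP[].
apply: (@leq_trans (\sum_(A : {set I} | #|A| <= k)
                     \max_(A : {set I} | 1 < #|A|) f A)); last first.
  by rewrite sum_nat_cond_const leq_mul2r card_sets_le orbT.
rewrite big_mkcond [X in _ <= X]big_mkcond; apply: leq_sum => A _.
case: ifP => // /andP[A1 ->].
by rewrite (@leq_bigmax_cond _ (fun A : {set I} => 1 < #|A|) f).
Qed.

(** Views a triple as one vertex set; for [I = 'I_d] the type [I + I + I] is [Vmod d]. *)
Definition triple_set (t : triple) : {set I + I + I} :=
  [set u | match u with
           | inl (inl x) => x \in t.1.1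
           | inl (inr y) => y \in t.1.2
           | inr z => z \in t.2
           end].

Lemma triple_set_inj : injective triple_set.
Proof.
move=> [[A B] C] [[A' B'] C'] /setP e.
congr (_, _, _); apply/setP => x.
- by have := e (inl (inl x)); rewrite !inE.
- by have := e (inl (inr x)); rewrite !inE.
- by have := e (inr x); rewrite !inE.
Qed.

(** * Fingerprint graphs, and triples of large sets *)

Section Fingerprint.
Variable T : I -> I -> I -> bool.
Hypothesis lT : latin T.
Variables (k : nat) (F G H : {set I}).
Hypotheses (Fk : #|F| = k) (Gk : #|G| = k) (Hk : #|H| = k).

Definition fingerprint_graph (u v : I + I + I) :=
  match u, v with
  | inl (inl x), inl (inr y) | inl (inr y), inl (inl x) => [exists z in H, T x y z]
  | inl (inl x), inr z | inr z, inl (inl x) => [exists y in G, T x y z]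
  | inl (inr y), inr z | inr z, inl (inr y) => [exists x in F, T x y z]
  | _, _ => false
  end.

Lemma fingerprint_graph_sym : symmetric fingerprint_graph.
Proof. by move=> [[x|x]|x] [[y|y]|y]. Qed.

Lemma fingerprint_graph_irrefl : irreflexive fingerprint_graph.
Proof. by move=> [[x|x]|x]. Qed.

Lemma card_set_sum3 (P : pred (I + I + I)) :
  #|[set u | P u]| = #|[set x | P (inl (inl x))]| + #|[set y | P (inl (inr y))]|
                     + #|[set z | P (inr z)]|.
Proof. by rewrite -!sum1dep_card !big_sumType. Qed.

Lemma card_image_graph (m : I -> I) (X : {set I}) : injective m ->
  #|[set b | [exists a in X, m a == b]]| = #|X|.
Proof.
move=> m_inj; rewrite -[RHS](card_imset _ m_inj); apply: eq_card => b.
rewrite inE; apply/exists_inP/imsetP => [[a aX /eqP<-]|[a aX ->]]; by exists a.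
Qed.

Lemma card_preimage_graph (m : I -> I) (X : {set I}) : injective m ->
  #|[set b | [exists a in X, m b == a]]| = #|X|.
Proof.
move=> m_inj; rewrite -[RHS](card_preimset _ m_inj); apply: eq_card => b.
by rewrite !inE; apply/exists_inP/idP => [[a aX /eqP->]|bX] //; exists (m b).
Qed.

(** In each of the two other parts, the neighbours of [v] are the image or preimage of a [k]-set
    under a permutation. *)
Lemma fingerprint_graph_regular v : #|[set u | fingerprint_graph v u]| = k.*2.
Proof.
have none : #|[set x : I | false]| = 0 by apply: eq_card0 => x; rewrite inE.
rewrite card_set_sum3 -addnn; case: v => [[x|y]|z] /=.
- have [m m_inj Tm] := latin_fun x lT.
  rewrite none add0n -{1}Hk -Gk -(card_preimage_graph H m_inj).
  rewrite -(card_image_graph G m_inj).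
  by congr (_ + _); apply: eq_card => u; rewrite !inE; apply: eq_existsb => ?; rewrite Tm.
- have [m m_inj Tm] := latin_fun y (latin_rot lT).
  rewrite none addn0 -{1}Hk -Fk -(card_image_graph H m_inj).
  rewrite -(card_preimage_graph F m_inj).
  by congr (_ + _); apply: eq_card => u; rewrite !inE; apply: eq_existsb => ?;
    rewrite -Tm.
- have [m m_inj Tm] := latin_fun z (latin_rot (latin_rot lT)).
  rewrite none addn0 -{1}Gk -Fk -(card_preimage_graph G m_inj).
  rewrite -(card_image_graph F m_inj).
  by congr (_ + _); apply: eq_card => u; rewrite !inE; apply: eq_existsb => ?;
    rewrite -Tm.
Qed.

(** An edge inside the triple, together with the element of [F], [G] or [H] that created it, would
    be a forbidden solution within [A], [B], [C]. *)
Lemma card_avoid_fingerprint :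
  #|[set t : triple | [&& avoid T t.1.1 t.1.2 t.2,
       F \subset t.1.1, G \subset t.1.2 & H \subset t.2]]|
    <= #|stables fingerprint_graph setT|.
Proof.
rewrite -(card_imset _ triple_set_inj); apply/subset_leq_card/subsetP => W.
case/imsetP=> -[[A B] C]; rewrite !inE /= subsetT => /and4P[/avoidP h].
move=> /subsetP sF /subsetP sG /subsetP sH ->; apply/stableP.
have no_xy x y : x \in A -> y \in B -> ~~ [exists z in H, T x y z].
  by move=> xA yB; apply/exists_inPn => z /sH; apply: h.
have no_xz x z : x \in A -> z \in C -> ~~ [exists y in G, T x y z].
  by move=> xA zC; apply/exists_inPn => y /sG yB; apply: h.
have no_yz y z : y \in B -> z \in C -> ~~ [exists x in F, T x y z].
  by move=> yB zC; apply/exists_inPn => x /sF xA; apply: h.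
by move=> [[x|x]|x] [[y|y]|y]; rewrite !inE /= => *; auto.
Qed.

End Fingerprint.

Lemma card_bigcup_le (J K : finType) (X : {set J}) (Y : J -> {set K}) n :
  (forall j, j \in X -> #|Y j| <= n) -> #|\bigcup_(j in X) Y j| <= #|X| * n.
Proof.
move=> h; rewrite -sum_nat_const.
apply: (big_ind2 (fun (S : {set K}) l => #|S| <= l)); rewrite ?cards0 //.
by move=> S l S' l' hS hS'; rewrite (leq_trans (leq_card_setU _ _)) // leq_add.
Qed.

Lemma count_avoid_large T k n : latin T ->
    (forall F G H : {set I}, #|F| = k -> #|G| = k -> #|H| = k ->
       #|stables (fingerprint_graph T F G H) setT| <= n) ->
  count_avoid T (fun A B C => [&& k <= #|A|, k <= #|B| & k <= #|C|])
    <= #|I|.+1 ^ (3 * k) * n.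
Proof.
move=> lT hn; pose X := [set A : {set I} | #|A| == k].
have Xk : #|X| <= #|I|.+1 ^ k.
  apply: leq_trans (card_sets_le k); apply/subset_leq_card/subsetP => A.
  by rewrite !inE => /eqP->.
have sub (A : {set I}) : k <= #|A| -> exists2 F, F \in X & F \subset A.
  case/card_geqP=> r [r_uniq r_size rA]; exists [set x in r].
    by rewrite inE cardsE (card_uniqP r_uniq) r_size.
  by apply/subsetP => x; rewrite inE; apply: rA.
apply: (@leq_trans (#|setX (setX X X) X| * n)); last first.
  by rewrite !cardsX leq_mul2r (mulnC 3) expnM 3!expnSr expn0 mul1n !leq_mul ?orbT.
apply: leq_trans (card_bigcup_le (Y := fun f : triple =>
  [set t : triple | [&& avoid T t.1.1 t.1.2 t.2,
       f.1.1 \subset t.1.1, f.1.2 \subset t.1.2 & f.2 \subset t.2]]) _); last first.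
  move=> [[F G] H]; rewrite !inE /= => /andP[/andP[/eqP Fk /eqP Gk] /eqP Hk].
  exact: leq_trans (card_avoid_fingerprint _ _ _ _) (hn _ _ _ Fk Gk Hk).
apply/subset_leq_card/subsetP => -[[A B] C]; rewrite inE /=.
case/and4P=> hABC /sub[F FX FA] /sub[G GX GB] /sub[H HX HC].
apply/bigcupP; exists (F, G, H); last by rewrite inE /= hABC FA GB.
by rewrite !in_setX /= FX GX.
Qed.

(** * Inclusion-exclusion over the sizes of the three sets *)

Lemma count_avoidE T P :
  count_avoid T P = \sum_(t : triple) (avoid T t.1.1 t.1.2 t.2 && P t.1.1 t.1.2 t.2).
Proof. by rewrite /count_avoid -sum1dep_card big_mkcond. Qed.

Lemma count_avoid_le T k :
  count_avoid T (fun _ _ _ => true) <=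
    count_avoid T (fun A _ _ => #|A| <= 1)
    + count_avoid T (fun _ B _ => #|B| <= 1)
    + count_avoid T (fun _ _ C => #|C| <= 1)
    + count_avoid T (fun A _ _ => 1 < #|A| <= k)
    + count_avoid T (fun _ B _ => 1 < #|B| <= k)
    + count_avoid T (fun _ _ C => 1 < #|C| <= k)
    + count_avoid T (fun A B C => [&& k <= #|A|, k <= #|B| & k <= #|C|]).
Proof.
rewrite !count_avoidE -!big_split /=; apply: leq_sum => t _.
by case: (avoid _ _ _ _) => //=; lia.
Qed.

(** Bonferroni: [s <= 1 + s (s - 1) / 2] when [s] of the three conditions hold. The pairs are in
    cyclic order so that rotations exchange them. *)
Lemma count_avoid_ge T :
  count_avoid T (fun A _ _ => #|A| <= 1)
  + count_avoid T (fun _ B _ => #|B| <= 1)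
  + count_avoid T (fun _ _ C => #|C| <= 1)
  <= count_avoid T (fun _ _ _ => true)
     + count_avoid T (fun A B _ => (#|A| <= 1) && (#|B| <= 1))
     + count_avoid T (fun _ B C => (#|B| <= 1) && (#|C| <= 1))
     + count_avoid T (fun A _ C => (#|C| <= 1) && (#|A| <= 1)).
Proof.
rewrite !count_avoidE -!big_split /=; apply: leq_sum => t _.
by case: (avoid _ _ _ _) => //=; lia.
Qed.

End Latin.

(** * Addition modulo [d] as a Latin square *)

Definition mod_rel d (x y z : 'I_d) := (x + y) %% d == z %% d.

Lemma mod_rel_latin d : latin (@mod_rel d).
Proof.
(* For [d = 0] all is vacuous; for [n.+1] the group structure of ['I_n.+1] solves for each
   coordinate. *)
case: d => [|n]; first by split=> -[].
have E x y z : @mod_rel n.+1 x y z = (x + y == z)%R.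
  by rewrite /mod_rel (modn_small (ltn_ord z)).
split=> [x y|x z|y z]; apply/eqP/cards1P.
- by exists (x + y)%R; apply/setP => z; rewrite !inE E eq_sym.
- exists (z - x)%R; apply/setP => y.
  by rewrite !inE E eq_sym addrC -subr_eq eq_sym.
- exists (z - y)%R; apply/setP => x.
  by rewrite !inE E eq_sym -subr_eq eq_sym.
Qed.

Lemma i_HmodE d : i_Hmod d = count_avoid (@mod_rel d) (fun _ _ _ => true).
Proof.
rewrite /count_avoid -(card_imset _ (@triple_set_inj _)).
apply: eq_card => /= W; rewrite inE; apply/forall_inP/imsetP.
  move=> hW; exists ([set x | inl (inl x) \in W], [set y | inl (inr y) \in W],
                     [set z | inr z \in W]); last first.
    by apply/setP => -[[x|y]|z]; rewrite !inE.
  rewrite inE andbT; apply/avoidP => x y z /=; rewrite !inE => xW yW zW.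
  apply/negP => xyz.
  have /hW/negP[] : [set (inl (inl x) : Vmod d); inl (inr y); inr z] \in Emod d.
    rewrite inE; apply/existsP; exists x; apply/existsP; exists y.
    by apply/existsP; exists z; rewrite eqxx andbT.
  by apply/subsetP => u; rewrite !inE => /orP[/orP[]|] /eqP->.
case=> -[[A B] C]; rewrite inE andbT => /avoidP h -> e; rewrite inE.
case/existsP=> x /existsP[y /existsP[z /andP[xyz /eqP->]]]; apply/negP => /subsetP sW.
have := sW (inl (inl x)); have := sW (inl (inr y)); have := sW (inr z).
rewrite !inE !eqxx ?orbT => /(_ isT) zC /(_ isT) yB /(_ isT) xA.
by have /negP[] := h x y z xA yB zC.
Qed.

(** * Real estimates and conclusion *)

Local Open Scope ring_scope.

Lemma bernoulli (R : realFieldType) (h : R) n : 0 <= h -> 1 + n%:R * h <= (1 + h) ^+ n.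
Proof.
move=> h0; elim: n => [|n IHn]; first by rewrite mul0r addr0 expr0.
rewrite exprS; apply: le_trans (_ : (1 + h) * (1 + n%:R * h) <= _).
  by rewrite -natr1; have := ler0n R n; nra.
by rewrite ler_wpM2l //; lra.
Qed.

(** Induct on [m], splitting [b] into two factors [s = sqrt b]: one absorbs [m] powers of [d + 1] by
    induction, the other absorbs the last power by Bernoulli. *)
Lemma poly_le_exp (R : rcfType) m (b : R) : 1 < b ->
  exists2 K, 0 < K & forall d : nat, d.+1%:R ^+ m <= K * b ^+ d.
Proof.
elim: m b => [|m IHm] b b1.
  by exists 1 => // d; rewrite expr0 mul1r exprn_ege1 // ltW.
pose s := Num.sqrt b.
have s1 : 1 < s by rewrite -[1]sqrtr1 ltr_sqrt // (lt_trans _ b1).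
have ss : s * s = b by rewrite -expr2 sqr_sqrtr // ltW // (lt_trans _ b1).
have [K K0 hK] := IHm s s1.
pose h := s - 1; have h0 : 0 < h by rewrite subr_gt0.
have K1 : 0 < 1 + h^-1 by rewrite addr_gt0 // invr_gt0.
exists ((1 + h^-1) * K) => [|d]; first exact: mulr_gt0.
rewrite exprS -ss exprMn mulrACA; apply: ler_pM => //; rewrite ?exprn_ge0 //.
apply: le_trans (_ : (1 + h^-1) * (1 + d%:R * h) <= _); last first.
  by rewrite ler_pM2l // (_ : s = 1 + h) ?bernoulli ?ltW // /h; ring.
rewrite -natr1 (_ : (1 + h^-1) * _ = 1 + d%:R * h + h^-1 + d%:R); last first.
  by field; rewrite gt_eqF.
have : 0 <= d%:R * h by rewrite mulr_ge0 // ltW.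
have : 0 < h^-1 by rewrite invr_gt0.
lra.
Qed.

Lemma le_root_exp (R : realFieldType) (x a b : R) m d : 0 <= x -> 0 <= b ->
  (0 < m)%N -> x ^+ m <= a ^+ d -> 0 <= a -> a <= b ^+ m -> x <= b ^+ d.
Proof.
move=> x0 b0 m0 xa a0 ab.
rewrite -(ler_pXn2r m0) ?nnegrE ?exprn_ge0 //.
by apply: le_trans xa _; rewrite -exprM mulnC exprM lerXn2r ?nnegrE ?exprn_ge0.
Qed.

Lemma count_avoid_small_real (R : realFieldType) (I : finType) T k : @latin I T ->
  (count_avoid T (fun A _ _ => 1 < #|A| <= k)%N)%:R
    <= #|I|.+1%:R ^+ k * (291 / 100) ^+ #|I| :> R.
Proof.
move=> lT; have [x x3 hx] := count_avoid_small k lT.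
apply: le_trans (_ : (#|I|.+1 ^ k * x)%:R <= _); first by rewrite ler_nat.
rewrite natrM natrX ler_wpM2l ?exprn_ge0 //.
(* [2.91 ^ 3 > 24]. *)
apply: (@le_root_exp _ _ 24 _ 3) => //; try lra.
by rewrite -!natrX ler_nat.
Qed.

Lemma count_avoid_large_real (R : realType) : exists k,
  forall (I : finType) T, @latin I T ->
  (count_avoid T (fun A B C => [&& k <= #|A|, k <= #|B| & k <= #|C|])%N)%:R
    <= #|I|.+1%:R ^+ (3 * k) * (296 / 100) ^+ #|I| :> R.
Proof.
(* [lam] is paid once for each of the [3 * d] vertices, and [2.95 * 1.001 ^ 3 < 2.96]. *)
pose lam : R := 1001 / 1000.
have [q q0 hq] : exists2 q, (0 < q)%N & 1 <= (lam - 1) * lam ^+ q.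
  have := @archi_boundP R (1000 * 1000) ltac:(lra); set q := Num.bound _ => hq.
  exists q; first by rewrite -(ltr_nat R); lra.
  have := @bernoulli R (lam - 1) q ltac:(rewrite /lam; lra).
  by rewrite [X in X ^+ _](_ : _ = lam); [move: hq; rewrite /lam; lra|ring].
(* The graph then has degree [20 * q], large against the threshold [q], so its sparse sets hold
   little more than half of the vertices. *)
exists (10 * q)%N.
move=> I T lT; set d := #|I|.
pose b : R := (296 / 100) ^+ d; have b0 : 0 <= b by rewrite exprn_ge0 //; lra.
have h := @count_avoid_large I T (10 * q) (Num.truncn b) lT _.
apply: le_trans (_ : (d.+1 ^ (3 * (10 * q)) * Num.truncn b)%:R <= _).
  rewrite ler_nat; apply: h.
  move=> F G H Fk Gk Hk; rewrite truncn_ge_nat //.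
  pose M : R := (295 / 100) ^+ d.
  apply: le_trans (_ : M * lam ^+ #|[set: I + I + I]| <= _).
    apply: (@card_stables_regular _ _ _ (10 * q).*2 q) => //.
    - exact: fingerprint_graph_sym.
    - exact: fingerprint_graph_irrefl.
    - exact: fingerprint_graph_regular.
    - by rewrite /lam; lra.
    move=> X; rewrite !card_sum -/d => hX.
    (* 20/39 * 3d <= 14/9 d, and 2^(14/9) < 2.95 *)
    have {}hX : (#|X| * 9 <= 14 * d)%N by nia.
    apply: (@le_root_exp _ _ (2 ^+ 14) _ 9) => //; rewrite ?exprn_ge0 //.
    - by lra.
    - by rewrite -!exprM ler_weXn2l //; lra.
    - by lra.
  rewrite cardsT !card_sum -/d (_ : (d + d + d)%N = (3 * d)%N); last by lia.
  rewrite exprM -exprMn lerXn2r ?nnegrE //; rewrite /lam; lra.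
by rewrite natrM natrX ler_wpM2l ?exprn_ge0 // truncn_le.
Qed.

Theorem theorem1 (R : realType) :
  exists (c K : R), 0 < c /\ 0 < K /\
    forall d : nat, (1 <= d)%N ->
      `| (i_Hmod d)%:R - 3 * 4 ^+ d - d%:R * 3 ^+ d.+1 | <= K * (3 - c) ^+ d.
Proof.
have [k hlarge] := count_avoid_large_real R.
(* Growth 1.01 absorbs the polynomial factors and still leaves [2.96 * 1.01 < 2.99]. *)
have b1 : 1 < 101 / 100 :> R by lra.
have [K1 K1_gt0 hK1] := poly_le_exp k b1.
have [K2 K2_gt0 hK2] := poly_le_exp (3 * k) b1.
have [K3 K3_gt0 hK3] := poly_le_exp 2 b1.
exists (1 / 100), (3 * K1 + K2 + 3 * K3); split; first by lra.
split=> [|d _]; first by lra.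
set B := (3 - 1 / 100) ^+ d.
have absorb K (a y : R) : 0 < K -> y <= K * (101 / 100) ^+ d -> 0 <= a <= 296 / 100 ->
    y * a ^+ d <= K * B.
  move=> K0 hy /andP[a0 ha].
  apply: le_trans (_ : K * (101 / 100) ^+ d * a ^+ d <= _).
    by rewrite ler_wpM2r // exprn_ge0.
  rewrite -mulrA -exprMn ler_pM2l // lerXn2r ?nnegrE //; lra.
have small T : latin T ->
    (count_avoid T (fun A _ _ : {set 'I_d} => 1 < #|A| <= k)%N)%:R <= K1 * B :> R.
  move=> lT; apply: le_trans (count_avoid_small_real R k lT) _.
  by rewrite card_ord; apply: absorb => //; lra.
have large T : latin T ->
    (count_avoid T (fun A B C : {set 'I_d} => [&& k <= #|A|, k <= #|B| & k <= #|C|])%N)%:R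
      <= K2 * B :> R.
  move=> lT; apply: le_trans (hlarge _ _ lT) _.
  by rewrite card_ord; apply: absorb => //; lra.
have pairs T :
    (count_avoid T (fun A B _ : {set 'I_d} => (#|A| <= 1) && (#|B| <= 1))%N)%:R
      <= K3 * B :> R.
  apply: le_trans (_ : (d.+1 ^ 2 * 2 ^ d)%:R <= _).
    by have := count_avoid_le1_le1 T; rewrite card_ord ler_nat.
  by rewrite natrM !natrX; apply: absorb => //; lra.
rewrite i_HmodE; set T := @mod_rel d.
have l0 : latin T := mod_rel_latin d.
have l1 := latin_rot l0; have l2 := latin_rot l1.
have := count_avoid_le T k; have := count_avoid_ge T.
(* Conditions on [B] take one rotation to reach the first set, those on [C] take two. *)
rewrite -(count_avoid_rot T (fun _ B _ => #|B| <= 1)%N).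
rewrite -(count_avoid_rot T (fun _ _ C => #|C| <= 1)%N).
rewrite -(count_avoid_rot (rot T) (fun _ C _ => #|C| <= 1)%N).
rewrite -(count_avoid_rot T (fun _ B _ => 1 < #|B| <= k)%N).
rewrite -(count_avoid_rot T (fun _ _ C => 1 < #|C| <= k)%N).
rewrite -(count_avoid_rot (rot T) (fun _ C _ => 1 < #|C| <= k)%N).
rewrite -(count_avoid_rot T (fun _ B C => (#|B| <= 1) && (#|C| <= 1))%N).
rewrite -(count_avoid_rot T (fun A _ C => (#|C| <= 1) && (#|A| <= 1))%N).
rewrite -(count_avoid_rot (rot T) (fun _ C A => (#|C| <= 1) && (#|A| <= 1))%N).
rewrite !count_avoid_le1 // card_ord -!(ler_nat R) !natrD !natrM !natrX.
have := large T l0.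
have := small _ l0; have := small _ l1; have := small _ l2.
have := pairs T; have := pairs (rot T); have := pairs (rot (rot T)).
have B0 : 0 <= B by rewrite exprn_ge0 //; lra.
have := mulr_ge0 (ltW K1_gt0) B0; have := mulr_ge0 (ltW K2_gt0) B0.
have := mulr_ge0 (ltW K3_gt0) B0.
(* The three main terms sum to [3 * (4 ^ d + d * 3 ^ d)], which is the subtracted quantity; the rest
   is linear in the bounded counts. *)
by rewrite exprS; move=> *; rewrite ler_norml; apply/andP; split; lra.
Qed.
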